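(* The Hilbert series $\mathcal{H}_{\mathsf{CAs}^{(3)}}(t) = \sum_{n\ge 1} \#\mathsf{CAs}^{(3)}(n)\, t^n$ of the $3$-comb associative operad $\mathsf{CAs}^{(3)}$ is $$\mathcal{H}_{\mathsf{CAs}^{(3)}}(t) = \frac{t}{(1-t)^2}\left(1 - t + t^2 + t^3 + 2t^4 + 2t^5 - 7t^7 - 2t^8 + t^9 + 2t^{10} + t^{11}\right).$$
   Context: Operads are nonsymmetric and set-theoretic. $\mathsf{Mag}$ is the free operad on one binary generator $\star$; its elements are the (planar, complete) binary trees, the arity of a tree being its number of leaves, and $\mathfrak{t}\circ_i\mathfrak{s}$ being obtained by grafting the root of $\mathfrak{s}$ onto the $i$-th leaf of $\mathfrak{t}$. An operad congruence on $\mathsf{Mag}$ is an arity-preserving equivalence relation compatible with all partial compositions $\circ_i$. $\mathsf{CAs}^{(3)} = \mathsf{Mag}/_{\equiv^{(3)}}$, where $\equiv^{(3)}$ is the smallest operad congruence of $\mathsf{Mag}$ identifying the left comb tree and the right comb tree with $3$ internal nodes, i.e. $(\star\circ_1\star)\circ_1\star \equiv^{(3)} \star\circ_2(\star\circ_2\star)$; equivalently $((x_1\star x_2)\star x_3)\star x_4 \equiv^{(3)} x_1\star(x_2\star(x_3\star x_4))$. $\mathsf{CAs}^{(3)}(n)$ is the (finite) set of elements of arity $n$, i.e. the set of $\equiv^{(3)}$-classes of binary trees with $n$ leaves. *)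

(* Defs.v *)
From HB Require Import structures.
From mathcomp Require Import all_boot all_order all_algebra.
From mathcomp Require Import boolp.

Set Implicit Arguments.
Unset Strict Implicit.
Unset Printing Implicit Defensive.

Import GRing.Theory.

(** * The magmatic operad *)

Inductive tree : Type := Leaf | Node of tree & tree.

Fixpoint leaves (t : tree) : nat :=
  if t is Node l r then leaves l + leaves r else 1.

(* [graft t i s] is the partial composition t o_i s; leaves are numbered from
   left to right starting at 1, so it is meaningful for 1 <= i <= leaves t. *)
Fixpoint graft (t : tree) (i : nat) (s : tree) : tree :=
  if t is Node l r then
    if i <= leaves l then Node (graft l i s) r
    else Node l (graft r (i - leaves l) s)
  else s.

Definition star : tree := Node Leaf Leaf.

Record operad_congruence (E : tree -> tree -> Prop) : Prop := OperadCongruence {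
  congr_refl  : forall t, E t t;
  congr_sym   : forall s t, E s t -> E t s;
  congr_trans : forall s t u, E s t -> E t u -> E s u;
  congr_arity : forall s t, E s t -> leaves s = leaves t;
  congr_graft : forall t t' s s' i, 1 <= i <= leaves t ->
    E t t' -> E s s' -> E (graft t i s) (graft t' i s') }.

Definition left_comb3 : tree := graft (graft star 1 star) 1 star.
Definition right_comb3 : tree := graft star 2 (graft star 2 star).

Definition equiv3 (s t : tree) : Prop :=
  forall E : tree -> tree -> Prop,
    operad_congruence E -> E left_comb3 right_comb3 -> E s t.

Lemma left_comb3E : left_comb3 = Node (Node (Node Leaf Leaf) Leaf) Leaf.
Proof. by []. Qed.

Lemma right_comb3E : right_comb3 = Node Leaf (Node Leaf (Node Leaf Leaf)).
Proof. by []. Qed.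

Lemma leaves_gt0 t : 0 < leaves t.
Proof. by elim: t => //= l Hl r _; rewrite addn_gt0 Hl. Qed.

Lemma leaves_graft t i s :
  1 <= i <= leaves t -> leaves (graft t i s) = leaves t + leaves s - 1.
Proof.
elim: t i => [|l IHl r IHr] i /=; first by rewrite addKn.
have s_gt0 := leaves_gt0 s; move=> /andP[i_gt0 le_i].
case: leqP => [le_il|lt_li] /=.
- rewrite IHl ?i_gt0 // -[leaves l + _ - 1]addnBA // -[RHS]addnBA //.
  by rewrite addnAC.
- rewrite IHr; last by rewrite subn_gt0 lt_li leq_subLR.
  by rewrite -addnBA // addnA addnBA.
Qed.

Lemma equiv3_congruence : operad_congruence equiv3.
Proof.
split.
- by move=> t E EC _; apply: (congr_refl EC).
- by move=> s t Est E EC Ec; apply: (congr_sym EC); apply: Est.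
- by move=> s t u Est Etu E EC Ec; apply: (congr_trans EC (Est E EC Ec) (Etu E EC Ec)).
- move=> s t /(_ (fun s t => leaves s = leaves t)) => arP.
  apply: arP => //; split=> // [s1 t1 u1 -> // | t1 t2 s1 s2 i le_i Et Es].
  by rewrite !leaves_graft -?Et ?Es.
- by move=> t t' s s' i le_i Et Es E EC Ec; apply: (congr_graft EC) => //;
    [apply: Et | apply: Es].
Qed.

Lemma equiv3_comb : equiv3 left_comb3 right_comb3.
Proof. by []. Qed.

(** * The finite type of trees of a given arity *)

Fixpoint tree_encode (t : tree) : GenTree.tree unit :=
  if t is Node l r then GenTree.Node 0 [:: tree_encode l; tree_encode r]
  else GenTree.Leaf tt.

Fixpoint tree_decode (g : GenTree.tree unit) : option tree :=
  match g with
  | GenTree.Leaf _ => Some Leaf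
  | GenTree.Node _ [:: gl; gr] =>
      if (tree_decode gl, tree_decode gr) is (Some l, Some r)
      then Some (Node l r) else None
  | _ => None
  end.

Lemma tree_encodeK : pcancel tree_encode tree_decode.
Proof. by elim=> //= l -> r ->. Qed.

HB.instance Definition _ := Countable.copy tree (pcan_type tree_encodeK).

Definition Mag (n : nat) : Type := {t : tree | leaves t == n}.

HB.instance Definition _ n := SubCountable.copy (Mag n) {t : tree | leaves t == n}.

Fixpoint trees_depth (d : nat) : seq tree :=
  if d is d'.+1 then
    Leaf :: [seq Node l r | l <- trees_depth d', r <- trees_depth d']
  else [::].

Lemma mem_trees_depth t d : leaves t <= d -> t \in trees_depth d.
Proof.
elim: t d => [|l IHl r IHr] [|d] //=; first by rewrite leqNgt addn_gt0 leaves_gt0.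
move=> le_d; rewrite in_cons /=; apply: allpairs_f; [apply: IHl | apply: IHr].
- rewrite -ltnS; apply: leq_trans le_d; by rewrite -[ltnLHS]addn0 ltn_add2l leaves_gt0.
- rewrite -ltnS; apply: leq_trans le_d; by rewrite -[ltnLHS]add0n ltn_add2r leaves_gt0.
Qed.

Definition Mag_enum n : seq (Mag n) := undup (pmap insub (trees_depth n)).

Lemma Mag_enumP n : Finite.axiom (Mag_enum n).
Proof.
apply: Finite.uniq_enumP => [|t]; first exact: undup_uniq.
rewrite mem_undup mem_pmap_sub; apply: mem_trees_depth.
by rewrite (eqP (valP t)).
Qed.

HB.instance Definition _ n := isFinite.Build (Mag n) (@Mag_enumP n).

Definition CAs3 (n : nat) : {set {set Mag n}} :=
  equivalence_partition
    (fun s t : Mag n => `[< equiv3 (val s) (val t) >]) [set: Mag n].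

(** * Formal power series *)

Local Open Scope ring_scope.

Record fps (R : Type) := Fps { fps_coef : nat -> R }.

HB.instance Definition _ (R : Type) := gen_eqMixin (fps R).
HB.instance Definition _ (R : Type) := gen_choiceMixin (fps R).

Lemma fpsP (R : Type) (f g : fps R) : fps_coef f =1 fps_coef g -> f = g.
Proof. by case: f g => [f] [g] /= /funext ->. Qed.

Section FpsZmodule.
Variable R : zmodType.
Implicit Types f g h : fps R.

Definition fps_zero : fps R := Fps (fun _ => 0).
Definition fps_opp f : fps R := Fps (fun n => - fps_coef f n).
Definition fps_add f g : fps R := Fps (fun n => fps_coef f n + fps_coef g n).

Fact fps_addA : associative fps_add.
Proof. by move=> f g h; apply: fpsP => n; apply: addrA. Qed.
Fact fps_addC : commutative fps_add.
Proof. by move=> f g; apply: fpsP => n; apply: addrC. Qed.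
Fact fps_add0 : left_id fps_zero fps_add.
Proof. by move=> f; apply: fpsP => n; apply: add0r. Qed.
Fact fps_addN : left_inverse fps_zero fps_opp fps_add.
Proof. by move=> f; apply: fpsP => n; apply: addNr. Qed.

HB.instance Definition _ :=
  GRing.isZmodule.Build (fps R) fps_addA fps_addC fps_add0 fps_addN.
End FpsZmodule.

Section FpsRing.
Variable R : comNzRingType.
Implicit Types f g h : fps R.

Definition fps_one : fps R := Fps (fun n => (n == 0)%:R).
Definition fps_mul f g : fps R :=
  Fps (fun n => \sum_(i < n.+1) fps_coef f i * fps_coef g (n - i)).

Definition fps_trunc (m : nat) f : {poly R} := \poly_(i < m) fps_coef f i.

Lemma coef_mul_trunc m n f g (p q : {poly R}) : (n < m)%N ->
    (forall i, (i < m)%N -> p`_i = fps_coef f i) ->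
    (forall i, (i < m)%N -> q`_i = fps_coef g i) ->
  (p * q)`_n = fps_coef (fps_mul f g) n.
Proof.
move=> lt_nm pE qE; rewrite coefM; apply: eq_bigr => i _.
rewrite pE; last by apply: leq_trans lt_nm; apply: ltn_ord.
by rewrite qE //; apply: leq_ltn_trans lt_nm; apply: leq_subr.
Qed.

Lemma coef_fps_trunc m f i : (i < m)%N -> (fps_trunc m f)`_i = fps_coef f i.
Proof. by move=> lt_im; rewrite coef_poly lt_im. Qed.

Fact fps_mulA : associative fps_mul.
Proof.
move=> f g h; apply: fpsP => n.
have T := @coef_fps_trunc n.+1.
rewrite -(@coef_mul_trunc n.+1 n f _ (fps_trunc n.+1 f)
           (fps_trunc n.+1 g * fps_trunc n.+1 h)) //; last 2 first.
- exact: T.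
- by move=> i lt_i; apply: (@coef_mul_trunc n.+1) => //; apply: T.
rewrite mulrA; apply: (@coef_mul_trunc n.+1) => //; last exact: T.
by move=> i lt_i; apply: (@coef_mul_trunc n.+1) => //; apply: T.
Qed.

Fact fps_mulC : commutative fps_mul.
Proof.
move=> f g; apply: fpsP => n; have T := @coef_fps_trunc n.+1.
rewrite -(@coef_mul_trunc n.+1 n f g (fps_trunc n.+1 f) (fps_trunc n.+1 g)) //;
  try exact: T.
by rewrite mulrC; apply: (@coef_mul_trunc n.+1) => //; apply: T.
Qed.

Fact fps_mul1 : left_id fps_one fps_mul.
Proof.
move=> f; apply: fpsP => n /=; rewrite big_ord_recl /= mul1r subn0.
by rewrite big1 ?addr0 // => i _; rewrite mul0r.
Qed.

Fact fps_mulDl : left_distributive fps_mul +%R.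
Proof.
move=> f g h; apply: fpsP => n /=; rewrite -big_split /=.
by apply: eq_bigr => i _; rewrite mulrDl.
Qed.

Fact fps_oner_neq0 : fps_one != 0.
Proof.
apply/eqP => /(congr1 (fun f => fps_coef f 0)) /= /eqP.
by rewrite oner_eq0.
Qed.

HB.instance Definition _ :=
  GRing.Zmodule_isComNzRing.Build (fps R)
    fps_mulA fps_mulC fps_mul1 fps_mulDl fps_oner_neq0.

Definition fps_var : fps R := Fps (fun n => (n == 1)%:R).
End FpsRing.

Section FpsUnitRing.
Variable R : comUnitRingType.
Implicit Types f g : fps R.

(* A series is a unit iff its constant coefficient is; the coefficients g_n of
   the inverse then solve \sum_(i <= n) f_(n - i) g_i = (n == 0). *)
Definition fps_unit : pred (fps R) :=
  fun f => fps_coef f 0 \is a GRing.unit.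

Fixpoint fps_inv_seq f (n : nat) : seq R :=
  if n is m.+1 then
    let s := fps_inv_seq f m in
    rcons s ((fps_coef f 0)^-1 *
             ((m == 0)%:R - \sum_(i < m) fps_coef f (m - i) * s`_i))
  else [::].

Definition fps_inv f : fps R :=
  if fps_unit f then Fps (fun n => (fps_inv_seq f n.+1)`_n) else f.

Lemma size_fps_inv_seq f n : size (fps_inv_seq f n) = n.
Proof. by elim: n => //= n IHn; rewrite size_rcons IHn. Qed.

Lemma nth_fps_inv_seq f n i :
  (i < n)%N -> (fps_inv_seq f n)`_i = (fps_inv_seq f i.+1)`_i.
Proof.
elim: n => //= n IHn; rewrite ltnS leq_eqVlt => /predU1P[-> //|lt_in].
rewrite nth_rcons size_fps_inv_seq lt_in IHn //.
Qed.

Fact fps_mulVr : {in fps_unit, left_inverse 1 fps_inv *%R}.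
Proof.
move=> f Uf; have f0U : fps_coef f 0 \is a GRing.unit := Uf.
rewrite /fps_inv ifT //; apply: fpsP => n /=.
rewrite big_ord_recr /= subnn nth_rcons size_fps_inv_seq ltnn eqxx.
rewrite [_ * fps_coef f 0]mulrC mulrA mulrV // mul1r addrC -addrA.
rewrite [X in _ + X](_ : _ = 0) ?addr0 //.
apply/eqP; rewrite addrC subr_eq0; apply/eqP; apply: eq_bigr => i _.
by rewrite mulrC -/(fps_inv_seq f i.+1) -[LHS]/(_ * (fps_inv_seq f i.+1)`_i)
  (@nth_fps_inv_seq f n).
Qed.

Fact fps_unitPl f g : g * f = 1 -> fps_unit f.
Proof.
move=> /(congr1 (fun h => fps_coef h 0)) /=.
rewrite big_ord1 subnn => gf1; apply/unitrPr; exists (fps_coef g 0).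
by rewrite mulrC.
Qed.

Fact fps_inv_out : {in [predC fps_unit], fps_inv =1 id}.
Proof. by move=> f Uf; rewrite /fps_inv ifN. Qed.

HB.instance Definition _ :=
  GRing.ComNzRing_hasMulInverse.Build (fps R) fps_mulVr fps_unitPl fps_inv_out.
End FpsUnitRing.

Notation "''t'" := (fps_var int) : ring_scope.

Lemma one_sub_var_unit : (1 - 't : fps int) \is a GRing.unit.
Proof. by []. Qed.

Definition hilbert_CAs3 : fps int :=
  Fps (fun n => if (1 <= n)%N then #|CAs3 n|%:R else 0).

(* Main.v *)
Require Import Defs.
From mathcomp Require Import all_boot all_order all_algebra.
From mathcomp Require Import boolp zify ring.

(** Write o for the leaf and xy for the tree with subtrees x and y.  The classes
    of arity n are the degree n elements of the magma generated by o subject to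
    ((ab)c)d = a(b(cd)), that is, trees modulo [comb_eq]; the claim amounts to
    their number being 1, 1, 2, 4, 8, 14, 20, 19, 16, 14 for n = 1, ..., 10 and
    n + 3 for n > 10.

    Lower bound.  A tree with no subtree of the form ((ab)c)d or a(b(cd)) is
    alone in its class, and such a tree consists of two zigzags glued at the
    root, which leaves n - 1 of them in arity n > 1 ([redexPn]).  The identity
    changes the depths of the leftmost and rightmost leaves by 0 or 2, so their
    parities are invariants; when n > 10, the trees with a redex (a subtree of
    one of these forms) realize all four pairs of parities ([genericP]), whence
    at least (n - 1) + 4 classes.

    Upper bound in large arity.  From arity 11 on, two trees with a redex and
    the same parities are congruent ([redex_collapses]).  By induction on the
    arity, up to congruence such a tree is a smaller one with a leaf replaced by
    a cherry ([peel_redex]), and the smaller one may be taken to be the generic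
    representative, a right comb up to its two ends.  Three identities of
    arity 8 and 9 ([shift_leaf_star], [shift_star_star], [shift_node_star]) push
    the cherry away from the root; what is then below the root has a redex and a
    smaller arity, and induction applies to it.

    Small arity.  The class of xy only depends on the classes of x and y, so the
    classes of arity n are obtained from those of smaller arities by merging the
    products that the identity relates.  This congruence closure is run in arity
    at most 11.  Its merges are sound by construction
    ([table_sound]); that none is missing up to arity 10 holds because the
    resulting partial magma satisfies the identity ([comb_eq_nf]).  The closure
    also yields the three shift identities and the base of the induction.

    Finally, multiplication by (1 - t)^2 takes second differences, which vanish
    from degree 13 on. *)

Set Implicit Arguments.
Unset Strict Implicit.
Unset Printing Implicit Defensive.
Import GRing.Theory.

(** * The congruence as a magma congruence *)

(** The description of [equiv3] to reason by induction on: since the identity is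
    imposed for all a, b, c, d, closure under grafting comes for free from
    closure under [Node]. *)
Inductive comb_eq : tree -> tree -> Prop :=
| comb_eq_refl t : comb_eq t t
| comb_eq_sym s t : comb_eq s t -> comb_eq t s
| comb_eq_trans s t u : comb_eq s t -> comb_eq t u -> comb_eq s u
| comb_eq_node l l' r r' :
    comb_eq l l' -> comb_eq r r' -> comb_eq (Node l r) (Node l' r')
| comb_eq_comb a b c d :
    comb_eq (Node (Node (Node a b) c) d) (Node a (Node b (Node c d))).

Hint Resolve comb_eq_refl : core.

Lemma comb_eq_leaves s t : comb_eq s t -> leaves s = leaves t.
Proof.
elim=> {s t} //= [s t u _ -> //|l l' r r' _ -> _ -> //|a b c d].
by rewrite !addnA.
Qed.

Lemma comb_eq_graft t t' s s' i : 1 <= i <= leaves t ->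
  comb_eq t t' -> comb_eq s s' -> comb_eq (graft t i s) (graft t' i s').
Proof.
move=> le_i tt' ss'; have graftr u j : comb_eq (graft u j s) (graft u j s').
  elim: u j => //= l IHl r IHr j.
  by case: ifP => _; apply: comb_eq_node.
apply: comb_eq_trans (graftr t' i); elim: tt' i le_i {ss' s' graftr}
  => {t t'} [//|t u tu IH i le_i|t u v tu IHtu _ IHuv i le_i
  |l l' r r' ll' IHl rr' IHr i /= le_i|a b c d i /= le_i].
- by apply/comb_eq_sym/IH; rewrite (comb_eq_leaves tu).
- apply: comb_eq_trans (IHtu i le_i) (IHuv i _).
  by rewrite -(comb_eq_leaves tu).
- case/andP: le_i => i_gt0 le_i; rewrite -(comb_eq_leaves ll').
  case: leqP => le_il; apply: comb_eq_node => //.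
    by apply: IHl; rewrite i_gt0.
  by apply: IHr; rewrite subn_gt0 le_il leq_subLR.
- have [le_a|lt_a] := leqP i (leaves a).
    by rewrite !ifT; first exact: comb_eq_comb; lia.
  have [le_b|lt_b] := leqP i (leaves a + leaves b).
    by rewrite !ifT; first exact: comb_eq_comb; lia.
  rewrite !subnDA (_ : (i - leaves a <= leaves b) = false); last lia.
  have [le_c|lt_c] := leqP i (leaves a + leaves b + leaves c).
    by rewrite !ifT; first exact: comb_eq_comb; lia.
  rewrite (_ : (i - leaves a - leaves b <= leaves c) = false); last lia.
  exact: comb_eq_comb.
Qed.

Lemma comb_eq_congruence : operad_congruence comb_eq.
Proof.
split; [exact: comb_eq_refl|exact: comb_eq_sym|exact: comb_eq_trans
       |exact: comb_eq_leaves|exact: comb_eq_graft].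
Qed.

Lemma equiv3_node l l' r r' :
  equiv3 l l' -> equiv3 r r' -> equiv3 (Node l r) (Node l' r').
Proof.
have [refl _ _ _ graftE] := equiv3_congruence.
move=> ll' rr'; apply: (graftE (graft star 2 r) (graft star 2 r') l l' 1) => //.
exact: graftE.
Qed.

(** Every instance of the identity is the comb relation with a, b, c, d grafted
    on its leaves, from right to left so that the positions do not shift. *)
Lemma equiv3P s t : equiv3 s t <-> comb_eq s t.
Proof.
split=> [|st]; first by apply; [exact: comb_eq_congruence|exact: comb_eq_comb].
have [refl sym trans _ graftE] := equiv3_congruence.
elim: st => {s t} [t|s t _|s t u _ st _|l l' r r' _ ll' _ rr'|a b c d].
- exact: refl.
- exact: sym.
- exact: trans.
- exact: equiv3_node.
have fill t t' u i (tt' : equiv3 t t') (le_i : 1 <= i <= leaves t) :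
    equiv3 (graft t i u) (graft t' i u) by exact: graftE.
have Ed := fill _ _ d 4 equiv3_comb isT; have Ec := fill _ _ c 3 Ed isT.
have Eb := fill _ _ b 2 Ec isT; exact: fill _ _ a 1 Eb isT.
Qed.

(** * Invariants and rigid trees *)

Fixpoint ldepth t := if t is Node l _ then (ldepth l).+1 else 0.
Fixpoint rdepth t := if t is Node _ r then (rdepth r).+1 else 0.

Lemma comb_eq_lparity s t : comb_eq s t -> odd (ldepth s) = odd (ldepth t).
Proof.
elim=> {s t} //= [s t u _ -> //|l l' r r' _ -> //|a b c d].
by rewrite !negbK.
Qed.

Lemma comb_eq_rparity s t : comb_eq s t -> odd (rdepth s) = odd (rdepth t).
Proof.
elim=> {s t} //= [s t u _ -> //|l l' r r' _ _ _ -> //|a b c d].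
by rewrite !negbK.
Qed.

(** A [Node l r] is ((ab)c)d exactly when the leftmost leaf of l has depth at
    least 2, and a(b(cd)) exactly when the rightmost leaf of r has. *)
Fixpoint redex t :=
  if t is Node l r then
    [|| 1 < ldepth l, 1 < rdepth r, redex l | redex r]
  else false.

(** Trees without a redex are alone in their class: no instance of the identity
    can start from them. *)
Lemma comb_eq_redex s t : comb_eq s t -> s = t \/ redex s && redex t.
Proof.
elim=> {s t} [t|s t _|s t u _ IHst _ IHtu|l l' r r' _ IHl _ IHr|a b c d].
- by left.
- by case=> [->|]; [left|rewrite andbC; right].
- case: IHst => [->//|/andP[rs rt]]; case: IHtu => [<-|/andP[_ ru]]; right;
  by rewrite rs ?rt.
- case: IHl => [->|/andP[rl rl']]; last by right; rewrite /= rl rl' !orbT.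
  by case: IHr => [->|/andP[rr rr']]; [left|right; rewrite /= rr rr' !orbT].
- by right; rewrite /= !orbT.
Qed.

(** The internal nodes form a path that turns right and left alternately; b
    tells whether it starts to the right. *)
Fixpoint zig b k :=
  if k is k'.+1 then
    if b then Node Leaf (zig false k') else Node (zig true k') Leaf
  else Leaf.

Lemma leaves_zig b k : leaves (zig b k) = k.+1.
Proof. by elim: k b => [|k IH] [] //=; rewrite IH // addn1. Qed.

Lemma zig_rigid b k :
  [/\ redex (zig b k) = false, b -> ldepth (zig b k) <= 1
    & ~~ b -> rdepth (zig b k) <= 1].
Proof.
elim: k b => [|k IH] [] //=.
  by have [-> _ /(_ isT) le1] := IH false; rewrite ltnNge le1.
by have [-> /(_ isT) le1 _] := IH true; rewrite ltnNge le1.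
Qed.

(** If the leftmost leaf of a node t has depth 1 then its left subtree is o, and
    the absence of a redex forces the rightmost leaf of its right subtree to
    have depth at most 1: the constraint alternates sides along the tree. *)
Lemma redexPn_zig t : ~~ redex t ->
  (ldepth t <= 1 -> t = zig true (leaves t).-1) /\
  (rdepth t <= 1 -> t = zig false (leaves t).-1).
Proof.
elim: t => [//|l IHl r IHr] /=; rewrite !negb_or -!leqNgt.
case/and4P=> le_l le_r /IHl[{}IHl _] /IHr[_ {}IHr].
split; rewrite ltnS leqn0.
  case: l {IHl le_l} => //= _.
  by rewrite {1}IHr // -[in RHS](prednK (leaves_gt0 r)).
case: r {IHr le_r} => //= _; rewrite {1}IHl // addn1 /=.
by rewrite -[in RHS](prednK (leaves_gt0 l)).
Qed.

Definition rigid i j := Node (zig true i) (zig false j).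

Lemma redex_rigid i j : redex (rigid i j) = false.
Proof.
have [/= -> /(_ isT) li _] := zig_rigid true i.
have [/= -> _ /(_ isT) rj] := zig_rigid false j.
by rewrite !ltnNge li rj.
Qed.

Lemma redexPn t : 1 < leaves t -> ~~ redex t ->
  exists2 i, i < (leaves t).-1 & t = rigid i ((leaves t).-2 - i).
Proof.
case: t => // l r _ /=; rewrite !negb_or -!leqNgt => /and4P[le_l le_r].
move=> /redexPn_zig[/(_ le_l) El _] /redexPn_zig[_ /(_ le_r) Er].
have [l0 r0] := (leaves_gt0 l, leaves_gt0 r).
exists (leaves l).-1; first lia.
by rewrite /rigid {1}El {1}Er; congr (Node _ (zig _ _)); lia.
Qed.

(** * Congruence closure in small arities *)

(** A comparison that, unlike the one inherited through the encoding of trees,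
    evaluates quickly. *)
Fixpoint eqt s t :=
  match s, t with
  | Leaf, Leaf => true
  | Node l r, Node l' r' => eqt l l' && eqt r r'
  | _, _ => false
  end.

Lemma eqtP s t : reflect (s = t) (eqt s t).
Proof.
elim: s t => [|l IHl r IHr] [|l' r'] /=; try by constructor.
by apply: (iffP andP) => [[/IHl -> /IHr ->]|[/IHl ? /IHr ?]].
Qed.

(** A row, one for each arity, maps the products xy of representatives to the
    representatives of their classes. *)
Definition row := seq (tree * tree).

(** The default value t is congruent to t, hence sound. *)
Fixpoint look (w : row) t :=
  if w is e :: w' then if eqt e.1 t then e.2 else look w' t else t.

(** The union step of union-find, on explicit labels. *)
Definition merge (w : row) (e : tree * tree) : row :=
  let u := look w e.1 in let v := look w e.2 in
  if eqt u v then w else [seq (x.1, if eqt x.2 v then u else x.2) | x <- w].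

Definition reps (w : row) : seq tree := [seq x.1 | x <- w & eqt x.1 x.2].

Definition splits X Y n (A : nat -> seq X) (B : nat -> seq Y) : seq (X * Y) :=
  flatten [seq [seq (x, y) | x <- A i, y <- B (n - i)] | i <- iota 1 n.-1].

Section Tables.
Variable T : seq row.

Definition level n : seq tree := reps (nth [::] T n).
Definition mul x y : tree := look (nth [::] T (leaves x + leaves y)) (Node x y).
Fixpoint nf t : tree := if t is Node l r then mul (nf l) (nf r) else Leaf.

Definition pairs n : seq (tree * tree) := splits n level level.
Definition quads n : seq (tree * tree * (tree * tree)) := splits n pairs pairs.

(** The two products, in a new row, that the identity equates: all the inner
    products have a smaller arity and are already normalized. *)
Definition sides (q : tree * tree * (tree * tree)) : tree * tree :=
  let: ((a, b), (c, d)) := q in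
  (Node (mul (mul a b) c) d, Node a (mul b (mul c d))).

Definition next_row n : row :=
  foldl merge [seq (Node p.1 p.2, Node p.1 p.2) | p <- pairs n]
        [seq sides q | q <- quads n].
End Tables.

(** [table n] has rows for the arities 0, ..., n + 1. *)
Fixpoint table n : seq row :=
  if n isn't m.+1 then [:: [::]; [:: (Leaf, Leaf)]]
  else let T := table m in rcons T (next_row T m.+2).

Definition sound (w : row) := forall t, comb_eq t (look w t).

Lemma sound_map (h : tree -> tree) w :
  (forall t, comb_eq t (h t)) -> sound w -> sound [seq (x.1, h x.2) | x <- w].
Proof.
move=> h_ok w_ok t; have {w_ok} := w_ok t; elim: w => //= x w IH.
by case: ifP => // _ tx; apply: comb_eq_trans tx (h_ok x.2).
Qed.

Lemma merge_sound w e : sound w -> comb_eq e.1 e.2 -> sound (merge w e).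
Proof.
move=> w_ok e12; rewrite /merge; set u := look w e.1; set v := look w e.2.
case: ifP => // _.
apply: (@sound_map (fun t => if eqt t v then u else t)) => // t.
case: eqtP => [->|//]; apply: comb_eq_trans _ (w_ok e.1).
exact: comb_eq_trans (comb_eq_sym (w_ok e.2)) (comb_eq_sym e12).
Qed.

Section TableTheory.
Variable T : seq row.

Definition sound_table := forall k, sound (nth [::] T k).
Hypothesis T_ok : sound_table.

Lemma mul_sound x y : comb_eq (Node x y) (mul T x y).
Proof. exact: T_ok. Qed.

Lemma nf_sound t : comb_eq t (nf T t).
Proof.
elim: t => //= l IHl r IHr.
exact: comb_eq_trans (comb_eq_node IHl IHr) (mul_sound _ _).
Qed.

Lemma nf_inj s t : nf T s = nf T t -> comb_eq s t.
Proof.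
move=> E; apply: comb_eq_trans (nf_sound s) _; rewrite E.
exact/comb_eq_sym/nf_sound.
Qed.

Lemma sides_sound q : comb_eq (sides T q).1 (sides T q).2.
Proof.
case: q => [[a b] [c d]] /=.
have ab_c : comb_eq (Node (Node a b) c) (mul T (mul T a b) c).
  apply: comb_eq_trans (mul_sound _ _).
  exact: comb_eq_node (mul_sound a b) (comb_eq_refl c).
have b_cd : comb_eq (Node b (Node c d)) (mul T b (mul T c d)).
  apply: comb_eq_trans (mul_sound _ _).
  exact: comb_eq_node (comb_eq_refl b) (mul_sound c d).
apply: comb_eq_trans (comb_eq_node (comb_eq_sym ab_c) (comb_eq_refl d)) _.
apply: comb_eq_trans (comb_eq_comb a b c d) _.
exact: comb_eq_node (comb_eq_refl a) b_cd.
Qed.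

Lemma next_row_sound n : sound (next_row T n).
Proof.
rewrite /next_row; set w := map _ _; have: sound w.
  move=> t; rewrite /w; elim: (pairs T n) => // p s IH.
  by case: t IH => //= l r IH; case: ifP => // /andP[/eqtP-> /eqtP->].
elim: (quads T n) w => //= q s IH w w_ok; apply: IH.
exact: merge_sound w_ok (sides_sound q).
Qed.

End TableTheory.

Lemma table_sound n : sound_table (table n).
Proof.
elim: n => [|n IH] k /=.
  by case: k => [|[|k]] [|l r] //=; rewrite nth_nil.
rewrite nth_rcons; case: ifP => _; first exact: IH.
by case: ifP => _ //; apply: next_row_sound.
Qed.

Lemma mem_splits (X Y : eqType) (A : nat -> seq X) (B : nat -> seq Y) i j x y :
  0 < i -> 0 < j -> x \in A i -> y \in B j -> (x, y) \in splits (i + j) A B.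
Proof.
move=> i_gt0 j_gt0 xA yB; apply/flatten_mapP; exists i.
  by rewrite mem_iota; lia.
by apply: allpairs_f; rewrite ?addKn.
Qed.

Definition level_closed T n :=
  all (fun p => has (eqt (mul T p.1 p.2)) (level T n)) (pairs T n).

Definition comb_model T n :=
  all (fun q => let: ((a, b), (c, d)) := q in
         eqt (mul T (mul T (mul T a b) c) d) (mul T a (mul T b (mul T c d))))
      (quads T n).

Lemma nf_level T m : all (level_closed T) (iota 2 m.-1) -> Leaf \in level T 1 ->
  forall t, leaves t <= m -> nf T t \in level T (leaves t).
Proof.
move=> T_closed T1; elim=> [//|l IHl r IHr] /=.
have [l_gt0 r_gt0] := (leaves_gt0 l, leaves_gt0 r) => le_m.
have /IHl{}IHl : leaves l <= m by lia.
have /IHr{}IHr : leaves r <= m by lia.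
have /(allP T_closed)/allP : leaves l + leaves r \in iota 2 m.-1.
  by rewrite mem_iota; lia.
move/(_ (nf T l, nf T r)) => /(_ (mem_splits l_gt0 r_gt0 IHl IHr)).
by case/hasP=> x x_in /eqtP->.
Qed.

(** The normal forms of arity at most m are a magma truncated at arity m; if it
    satisfies the identity, evaluation in it is constant on classes. *)
Lemma comb_eq_nf T m :
    all (level_closed T) (iota 2 m.-1) -> Leaf \in level T 1 ->
    all (comb_model T) (iota 2 m.-1) ->
  forall s t, comb_eq s t -> leaves s <= m -> nf T s = nf T t.
Proof.
move=> T_closed T1 T_comb.
move=> s t; elim=> {s t} //= [s t st IH|s t u st IHst _ IHtu
  |l l' r r' _ IHl _ IHr|a b c d] le_m.
- by rewrite IH // (comb_eq_leaves st).
- by rewrite IHst // IHtu // -(comb_eq_leaves st).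
- by rewrite IHl ?IHr //; lia.
have lev t : leaves t <= m -> nf T t \in level T (leaves t) by exact: nf_level.
have [a0 b0] := (leaves_gt0 a, leaves_gt0 b).
have [c0 d0] := (leaves_gt0 c, leaves_gt0 d).
have /(allP T_comb)/allP :
    (leaves a + leaves b) + (leaves c + leaves d) \in iota 2 m.-1.
  by rewrite mem_iota; lia.
move/(_ ((nf T a, nf T b), (nf T c, nf T d))) => comb.
apply/eqtP/comb/mem_splits; rewrite ?addn_gt0 ?a0 ?c0 //.
  by apply: mem_splits; rewrite ?lev //; lia.
by apply: mem_splits; rewrite ?lev //; lia.
Qed.

(** * Collapse in large arities *)

(** A right comb of arity k + 3 whose lower end is adjusted to give the depth of
    its rightmost leaf the parity rho. *)
Fixpoint vine k rho :=
  if k is k'.+1 then Node Leaf (vine k' (~~ rho))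
  else if rho then Node star Leaf else Node Leaf star.

(** The chosen tree of arity n with a redex for which lam and rho are the
    parities of the depths of the extreme leaves. *)
Definition generic n lam rho :=
  if lam then vine (n - 3) rho else Node star (vine (n - 5) (~~ rho)).

Definition generic_of t := generic (leaves t) (odd (ldepth t)) (odd (rdepth t)).

Definition collapses t := comb_eq t (generic_of t).

Lemma generic_of_eq s t : comb_eq s t -> generic_of s = generic_of t.
Proof.
move=> st; rewrite /generic_of.
by rewrite (comb_eq_leaves st) (comb_eq_lparity st) (comb_eq_rparity st).
Qed.

Lemma collapses_eq s t : comb_eq s t -> collapses t -> collapses s.
Proof.
by move=> st; rewrite /collapses (generic_of_eq st); apply: comb_eq_trans.
Qed.

Lemma leaves_vine k rho : leaves (vine k rho) = k.+3.
Proof. by elim: k rho => [|k IH] [] //=; rewrite IH. Qed.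

Lemma odd_rdepth_vine k rho : odd (rdepth (vine k rho)) = rho.
Proof. by elim: k rho => [|k IH] [] //=; rewrite IH. Qed.

Lemma rdepth_vine k rho : k < rdepth (vine k rho).
Proof. by elim: k rho => [|k IH] [] //=; rewrite ltnS IH. Qed.

Lemma collapses_vine k rho : collapses (vine k.+1 rho).
Proof.
rewrite /collapses /generic_of leaves_vine odd_rdepth_vine /generic .
by rewrite !subSS subn0.
Qed.

(** Generic representatives are stable under left multiplication by o and oo,
    as long as the leftmost leaf of the other factor has odd depth. *)
Lemma collapses_leaf_node w : 2 < leaves w -> odd (ldepth w) -> collapses w ->
  collapses (Node Leaf w).
Proof.
move=> w_gt2 w_odd /(comb_eq_node (comb_eq_refl Leaf)); rewrite /collapses.
rewrite /generic_of /generic w_odd /= add1n subSn //= negbK //.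
Qed.

Lemma collapses_star_node w : 2 < leaves w -> odd (ldepth w) -> collapses w ->
  collapses (Node star w).
Proof.
move=> w_gt2 w_odd /(comb_eq_node (comb_eq_refl star)); rewrite /collapses.
rewrite /generic_of /generic w_odd /= negbK.
by rewrite (_ : 1 + 1 + _ - 5 = leaves w - 3); last lia.
Qed.

Definition grows u t := exists2 i, 1 <= i <= leaves u & t = graft u i star.

Lemma grows_l l l' r : grows l l' -> grows (Node l r) (Node l' r).
Proof. by case=> i le_i ->; exists i => /=; [lia|rewrite ifT //; lia]. Qed.

Lemma grows_r l r r' : grows r r' -> grows (Node l r) (Node l r').
Proof.
case=> i le_i ->; exists (leaves l + i) => /=; first lia.
by rewrite ifF ?addKn //; lia.
Qed.

Lemma leaves_node_gt1 l r : 1 < leaves (Node l r).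
Proof. by have [l0 r0] := (leaves_gt0 l, leaves_gt0 r); rewrite /=; lia. Qed.

Lemma growsP t : 1 < leaves t -> exists u, grows u t.
Proof.
elim: t => // -[|l1 l2] IHl r IHr _; last first.
  have [|u ul] := IHl; last by exists (Node u r); apply: grows_l.
  exact: leaves_node_gt1.
case: r IHr => [|r1 r2] IHr; first by exists Leaf, 1.
have [|u ur] := IHr; last by exists (Node Leaf u); apply: grows_r.
exact: leaves_node_gt1.
Qed.

Lemma ldepth_gt1 t : 1 < ldepth t -> exists x y z, t = Node (Node x y) z.
Proof. by case: t => [|[|x y] z] // _; exists x, y, z. Qed.

Lemma rdepth_gt1 t : 1 < rdepth t -> exists x y z, t = Node x (Node y z).
Proof. by case: t => [|x [|y z]] // _; exists x, y, z. Qed.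

Lemma leaves_eq1 t : leaves t <= 1 -> t = Leaf.
Proof. by case: t => // l r; rewrite leqNgt leaves_node_gt1. Qed.

Lemma redex_gt3 t : redex t -> 3 < leaves t.
Proof.
elim: t => // l IHl r IHr /=; have [l0 r0] := (leaves_gt0 l, leaves_gt0 r).
case/or4P=> [/ldepth_gt1[x [y [z El]]]|/rdepth_gt1[x [y [z Er]]]|redl|redr].
- rewrite El /= {l0 El IHl IHr}.
  by have := leaves_gt0 x; have := leaves_gt0 y; have := leaves_gt0 z; lia.
- rewrite Er /= {r0 Er IHl IHr}.
  by have := leaves_gt0 x; have := leaves_gt0 y; have := leaves_gt0 z; lia.
- by have := IHl redl; clear IHl IHr; lia.
- by have := IHr redr; clear IHl IHr; lia.
Qed.

Lemma redex_arity4 t : redex t -> leaves t = 4 -> comb_eq t left_comb3.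
Proof.
case: t => // l r red_t t4.
have [l0 r0] := (leaves_gt0 l, leaves_gt0 r).
case/or4P: red_t t4 => [/ldepth_gt1[x [y [z ->]]]|/rdepth_gt1[x [y [z ->]]]
                       |/redex_gt3|/redex_gt3] /= => [t4|t4||]; try lia.
all: have [x0 y0 z0] := And3 (leaves_gt0 x) (leaves_gt0 y) (leaves_gt0 z).
  have [-> -> -> ->] : [/\ x = Leaf, y = Leaf, z = Leaf & r = Leaf].
    by split; apply: leaves_eq1; lia.
  exact: comb_eq_refl.
have [-> -> -> ->] : [/\ x = Leaf, y = Leaf, z = Leaf & l = Leaf].
  by split; apply: leaves_eq1; lia.
exact: comb_eq_sym (comb_eq_comb _ _ _ _).
Qed.

(** Contracting a cherry of t that does not belong to a chosen redex keeps that
    redex.  There is no such cherry only if the redex has arity 4 and sits at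
    the end of a caterpillar; one can then rewrite it into the comb which
    forms another redex with its parent. *)
Lemma peel_redex t : redex t -> 4 < leaves t ->
  exists u, exists s, [/\ redex u, comb_eq t s & grows u s].
Proof.
elim: t => // l IHl r IHr red_t t_gt4.
have [l0 r0] := (leaves_gt0 l, leaves_gt0 r).
have /or4P : [|| 1 < ldepth l, 1 < rdepth r, redex l | redex r] := red_t.
case=> {red_t} [/ldepth_gt1[x [y [z El]]]|/rdepth_gt1[x [y [z Er]]]|redl|redr].
- rewrite {l IHl l0}El {IHr} in t_gt4 *.
  have [/growsP[u ux]|x1] := ltnP 1 (leaves x).
    exists (Node (Node (Node u y) z) r), (Node (Node (Node x y) z) r).
    by split=> //; do 3!apply: grows_l.
  have [/growsP[u uy]|y1] := ltnP 1 (leaves y).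
    exists (Node (Node (Node x u) z) r), (Node (Node (Node x y) z) r).
    by split=> //; do 2!apply: grows_l; apply: grows_r.
  have [/growsP[u uz]|z1] := ltnP 1 (leaves z).
    exists (Node (Node (Node x y) u) r), (Node (Node (Node x y) z) r).
    by split=> //; apply: grows_l; apply: grows_r.
  have /growsP[u ur] : 1 < leaves r by move: t_gt4 => /=; lia.
  exists (Node (Node (Node x y) z) u), (Node (Node (Node x y) z) r).
  by split=> //; apply: grows_r.
- rewrite {r IHr r0}Er {IHl} in t_gt4 *.
  have [/growsP[u ux]|x1] := ltnP 1 (leaves x).
    exists (Node l (Node u (Node y z))), (Node l (Node x (Node y z))).
    by split=> //; [rewrite /= orbT|apply: grows_r; apply: grows_l].
  have [/growsP[u uy]|y1] := ltnP 1 (leaves y).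
    exists (Node l (Node x (Node u z))), (Node l (Node x (Node y z))).
    by split=> //; [rewrite /= orbT|do 2!apply: grows_r; apply: grows_l].
  have [/growsP[u uz]|z1] := ltnP 1 (leaves z).
    exists (Node l (Node x (Node y u))), (Node l (Node x (Node y z))).
    by split=> //; [rewrite /= orbT|do 3!apply: grows_r].
  have /growsP[u ul] : 1 < leaves l by move: t_gt4 => /=; lia.
  exists (Node u (Node x (Node y z))), (Node l (Node x (Node y z))).
  by split=> //; [rewrite /= orbT|apply: grows_l].
- have [/growsP[u ur]|r1] := ltnP 1 (leaves r).
    exists (Node l u), (Node l r).
    by split=> //; [rewrite /= redl !orbT|apply: grows_r].
  rewrite (leaves_eq1 r1) /= addn1 ltnS {r1 IHr r0} in t_gt4 *.
  have [l_gt4|l_le4] := ltnP 4 (leaves l).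
    have [u [s [redu ls us]]] := IHl redl l_gt4.
    exists (Node u Leaf), (Node s Leaf); split; last exact: grows_l.
      by rewrite /= redu !orbT.
    exact: comb_eq_node.
  exists left_comb3, (Node left_comb3 Leaf); split=> //; last by exists 1.
  by apply: comb_eq_node => //; apply: redex_arity4 => //; lia.
- have [/growsP[u ul]|l1] := ltnP 1 (leaves l).
    exists (Node u r), (Node l r).
    by split=> //; [rewrite /= redr !orbT|apply: grows_l].
  rewrite (leaves_eq1 l1) /= add1n ltnS {l1 IHl l0} in t_gt4 *.
  have [r_gt4|r_le4] := ltnP 4 (leaves r).
    have [u [s [redu rs us]]] := IHr redr r_gt4.
    exists (Node Leaf u), (Node Leaf s); split; last exact: grows_r.
      by rewrite /= redu !orbT.
    exact: comb_eq_node.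
  exists right_comb3, (Node Leaf right_comb3); split=> //; last by exists 4.
  apply: comb_eq_node => //; apply: comb_eq_trans (comb_eq_comb _ _ _ _).
  by apply: redex_arity4 => //; lia.
Qed.

Definition rcomb k x := iter k (Node Leaf) x.

(** The next three identities, stated with a tree x at the rightmost leaf, hold
    between concrete trees (x = o), where they are read off the table. *)
Lemma shift_leaf_star x :
  comb_eq (Node Leaf (Node star (rcomb 4 x))) (rcomb 5 (Node star x)).
Proof.
pose s y := Node Leaf (Node star (rcomb 4 y)).
pose t y := rcomb 5 (Node star y).
apply: (@comb_eq_graft (s Leaf) (t Leaf) x x 8) => //.
by apply: (nf_inj (table_sound 7)); vm_compute.
Qed.

Lemma shift_star_star x :
  comb_eq (Node star (Node star (rcomb 4 x)))
          (Node star (rcomb 4 (Node star x))).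
Proof.
pose s y := Node star (Node star (rcomb 4 y)).
pose t y := Node star (rcomb 4 (Node star y)).
apply: (@comb_eq_graft (s Leaf) (t Leaf) x x 9) => //.
by apply: (nf_inj (table_sound 8)); vm_compute.
Qed.

Lemma shift_node_star x :
  comb_eq (Node (Node Leaf star) (rcomb 4 x))
          (Node star (rcomb 3 (Node star x))).
Proof.
pose s y := Node (Node Leaf star) (rcomb 4 y).
pose t y := Node star (rcomb 3 (Node star y)).
apply: (@comb_eq_graft (s Leaf) (t Leaf) x x 8) => //.
by apply: (nf_inj (table_sound 7)); vm_compute.
Qed.

(** In arity 10, the trees with a redex whose extreme leaves both have even
    depth still form two classes, whence the condition. *)
Definition level_collapses T n :=
  all (fun x => redex x && (odd (ldepth x) || (10 < n)) ==>
                eqt (nf T (generic_of x)) x)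
      (level T n).

Definition level_normal T n :=
  all (fun x => eqt (nf T x) x && (leaves x == n)) (level T n) &&
  pairwise (fun x y => ~~ eqt x y) (level T n).

Definition small_sizes := [:: 1; 1; 2; 4; 8; 14; 20; 19; 16; 14].

Definition table_correct T :=
  [&& all (level_closed T) (iota 2 10), has (eqt Leaf) (level T 1),
      all (comb_model T) (iota 2 9),
      all (level_normal T) (iota 1 10),
      [seq size (level T n) | n <- iota 1 10] == small_sizes &
      all (level_collapses T) (iota 10 2)].

(** Only the existence of a table is retained, which prevents its unfolding in
    later proofs. *)
Lemma small_table : exists2 T, sound_table T & table_correct T.
Proof. by exists (table 10); [exact: table_sound|vm_compute]. Qed.

Lemma rdepth_graft t i s : rdepth t <= rdepth (graft t i s).
Proof.
elim: t i => //= l IHl r IHr i.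
by case: ifP => _ //=; rewrite ltnS IHr.
Qed.

Lemma redex_generic_of_small t : redex t -> 9 < leaves t <= 11 ->
  odd (ldepth t) || (10 < leaves t) -> collapses t.
Proof.
move=> red_t /andP[t_gt9 t_le11] t_ok.
have [T T_ok] := small_table.
case/and5P=> T_closed /hasP[_ /[swap] /eqtP<- T1] _ _ /andP[_ T_generic].
set x := nf T t; have tx : comb_eq t x := nf_sound T_ok t.
have x_level : x \in level T (leaves t).
  exact: (@nf_level T 11 T_closed T1 t t_le11).
move/allP/(_ (leaves t)): T_generic; rewrite mem_iota t_gt9 ltnS t_le11.
move=> /(_ isT)/allP/(_ x x_level).
rewrite -(comb_eq_lparity tx) t_ok.
have -> : redex x by case: (comb_eq_redex tx) => [<-|/andP[]].
move=> /eqtP nf_generic; apply: (comb_eq_trans tx).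
by rewrite -nf_generic (generic_of_eq tx); apply/comb_eq_sym/nf_sound.
Qed.

(** The new cherry of t is either near the root or inside the comb.  In
    each case t is congruent to ow or (oo)w where w is smaller, has a redex, and
    has its leftmost leaf at odd depth: t itself has this form if the cherry is
    far from the root; near the root, a shift or the identity may be needed to
    reach it. *)
Lemma collapses_grow n t : 11 <= n ->
    (forall w, redex w -> 9 < leaves w <= n ->
       odd (ldepth w) || (10 < leaves w) -> collapses w) ->
  forall lam rho, grows (generic n lam rho) t -> collapses t.
Proof.
move=> n_ge11 IH lam rho [i /andP[i_gt0 le_i] ->] {t}.
have [k {n_ge11}Ek] : exists k, n = k + 11 by exists (n - 11); lia.
have IHtail w : redex w -> leaves w <= n -> 9 < leaves w ->
    odd (ldepth w) -> collapses w.
  by move=> redw w_le w_gt w_odd; apply: IH; rewrite ?w_odd ?w_gt.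
have red_graft m b j : 1 < m -> redex (Node Leaf (graft (vine m b) j star)).
  move=> m_gt1; apply/or4P/Or42; apply: leq_trans (rdepth_graft _ _ _).
  exact: ltn_trans m_gt1 (rdepth_vine _ _).
have leaves_inner m b j : 0 < j <= m.+3 ->
    leaves (Node Leaf (graft (vine m b) j star)) = m.+4.+1.
  by move=> le_j; rewrite /= leaves_graft leaves_vine //=; lia.
case: lam le_i; rewrite /generic Ek.
  (* The comb starts at the root: leaves 1 and 2 are the ones near the root. *)
  rewrite (_ : k + 11 - 3 = k.+4.+4); last lia.
  case: i i_gt0 => // -[|[|i]] _ le_i.
  - exact: (@collapses_star_node (vine k.+4.+3 (~~ rho)) isT isT
              (collapses_vine _ _)).
  - apply: collapses_eq (shift_leaf_star (vine k.+2 _)) _.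
    apply: collapses_leaf_node => //.
    by apply: IHtail; rewrite //= ?leaves_vine ?Ek; lia.
  - rewrite leaves_vine in le_i.
    pose w := Node Leaf (graft (vine k.+4.+2 (~~ ~~ rho)) i.+1 star).
    have w_leaves : leaves w = k.+4.+2.+4.+1 by apply: leaves_inner; lia.
    apply: (@collapses_leaf_node w) => //; first lia.
    by apply: IHtail; rewrite ?red_graft ?w_leaves ?Ek //; lia.
(* The comb hangs under oo: leaves 1, 2 and 3 are the ones near the root. *)
rewrite (_ : k + 11 - 5 = k.+4.+2); last lia.
case: i i_gt0 => // -[|[|[|i]]] _ le_i.
- apply: collapses_eq (comb_eq_comb _ _ _ _) _.
  by clear le_i; case: rho; [apply: (collapses_vine k.+4.+4 true)
                            |apply: (collapses_vine k.+4.+4 false)].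
- apply: collapses_eq (shift_node_star (vine k.+2 _)) _.
  apply: collapses_star_node => //.
  by apply: IHtail; rewrite //= ?leaves_vine ?Ek; lia.
- apply: collapses_eq (shift_star_star (vine k.+1 _)) _.
  apply: collapses_star_node => //.
  by apply: IHtail; rewrite //= ?leaves_vine ?Ek; lia.
- rewrite /= leaves_vine in le_i.
  pose w := Node Leaf (graft (vine k.+4.+1 (~~ ~~ rho)) i.+1 star).
  have w_leaves : leaves w = k.+4.+1.+4.+1 by apply: leaves_inner; lia.
  apply: (@collapses_star_node w) => //; first lia.
  by apply: IHtail; rewrite ?red_graft ?w_leaves ?Ek //; lia.
Qed.

(** The case of an odd leftmost depth is needed one arity earlier: the factors
    of arity 10 that the induction step from arity 11 to 12 meets are of this
    kind. *)
Theorem redex_collapses t : redex t -> 9 < leaves t ->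
  odd (ldepth t) || (10 < leaves t) -> collapses t.
Proof.
have [n] := ubnP (leaves t); elim: n t => // n IH t t_le red_t t_gt9 t_ok.
have [t_le11|t_gt11] := leqP (leaves t) 11.
  by apply: redex_generic_of_small; rewrite ?t_gt9.
have [u [s [redu ts us]]] := peel_redex red_t (ltn_trans (isT : 4 < 9) t_gt9).
apply: (collapses_eq ts); case: us => i le_i Es.
have Eus : leaves s = leaves u + 1 by rewrite Es leaves_graft //= addnA addnK.
have Ets := comb_eq_leaves ts.
have u_ge11 : 10 < leaves u by lia.
have u_generic : collapses u by apply: IH; rewrite ?u_ge11 ?orbT //; lia.
rewrite Es.
apply: (collapses_eq (comb_eq_graft le_i u_generic (comb_eq_refl star))).
rewrite (comb_eq_leaves u_generic) in le_i.
apply: (collapses_grow u_ge11 _ (ex_intro2 _ _ i le_i erefl)).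
by move=> w redw /andP[w_gt9 w_le] w_ok; apply: IH => //; lia.
Qed.

(** * Counting the classes *)

(** Classes are counted by a normal form function f and the list L of its
    values. *)
Lemma card_CAs3_transversal n (f : tree -> tree) (L : seq tree) :
    uniq L -> {in L, forall t, leaves t = n /\ f t = t} ->
    (forall t, leaves t = n -> f t \in L) ->
    (forall t, leaves t = n -> comb_eq t (f t)) ->
    (forall s t, leaves s = n -> comb_eq s t -> f s = f t) ->
  #|CAs3 n| = size L.
Proof.
move=> L_uniq L_norm f_in f_eq f_const.
pose X := [set x : Mag n | val x \in L].
pose cls (x : Mag n) := [set y in [set: Mag n] | `[< equiv3 (val x) (val y) >]].
have clsP x y : (y \in cls x) = `[< comb_eq (val x) (val y) >].
  by rewrite !inE; apply: asbool_equiv_eq; apply: equiv3P.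
have clsE x y : comb_eq (val x) (val y) -> cls x = cls y.
  move=> xy; apply/setP=> z; rewrite !clsP; apply: asbool_equiv_eq.
  split; [apply: comb_eq_trans (comb_eq_sym xy)|exact: comb_eq_trans xy].
have -> : CAs3 n = cls @: X.
  apply/setP=> A; apply/imsetP/imsetP=> [[x _ ->]|[x _ ->]]; last by exists x.
  have xn : leaves (val x) = n by apply/eqP/(valP x).
  have [fxn _] := L_norm _ (f_in _ xn).
  exists (Sub (f (val x)) (introT eqP fxn)); first by rewrite inE /= f_in.
  by apply: clsE; apply: f_eq.
rewrite card_in_imset => [|x y]; last first.
  rewrite !inE => xL yL Exy.
  have [[xn fx] [_ fy]] := (L_norm _ xL, L_norm _ yL).
  have: y \in cls x by rewrite Exy clsP; apply/asboolP.
  rewrite clsP => /asboolP /(f_const _ _ xn); rewrite fx fy; exact: val_inj.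
have -> : X = [set x in pmap insub L].
  by apply/setP=> x; rewrite !inE mem_pmap_sub.
rewrite cardsE (card_uniqP _) ?pmap_sub_uniq // size_pmap_sub.
by apply/eqP; rewrite -all_count; apply/allP=> t /L_norm[/= -> _].
Qed.

Lemma card_CAs3_small n : 0 < n <= 10 -> #|CAs3 n| = nth 0 small_sizes n.-1.
Proof.
move=> n_in; have [n_gt0 n_le10] := andP n_in.
have n_iota : n \in iota 1 10 by rewrite mem_iota.
have [T T_ok] := small_table.
case/and5P=> T_closed /hasP[_ /[swap] /eqtP<- T1] T_comb T_norm.
case/andP=> /eqP T_sizes _.
have -> : nth 0 small_sizes n.-1 = size (level T n).
  have n_lt : n.-1 < 10 by rewrite prednK.
  by rewrite -T_sizes (nth_map 0) ?size_iota // nth_iota // add1n prednK.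
have /andP[/allP L_norm L_uniq] := allP T_norm n n_iota.
apply: (card_CAs3_transversal (f := nf T)).
- rewrite uniq_pairwise; apply: sub_pairwise L_uniq => x y.
  by apply: contra => /eqP ->; apply/eqtP.
- by move=> t /L_norm /andP[/eqtP-> /eqP].
- by move=> t tn; rewrite -tn; apply: (@nf_level T 11) => //; rewrite tn ltnW.
- by move=> t _; apply: nf_sound.
move=> s t sn st; apply: (@comb_eq_nf T 10) => //; last by rewrite sn.
apply/allP=> k k_in; apply: (allP T_closed).
by move: k_in; rewrite !mem_iota => /andP[-> /ltnW].
Qed.

Lemma genericP n lam rho : 10 < n ->
  [/\ leaves (generic n lam rho) = n, redex (generic n lam rho),
      odd (ldepth (generic n lam rho)) = lam
    & odd (rdepth (generic n lam rho)) = rho].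
Proof.
move=> n_gt10; have -> : n = (n - 11) + 11 by lia.
move: (n - 11) => k; rewrite /generic; case: lam.
  rewrite (_ : k + 11 - 3 = k.+4.+4) ?leaves_vine ?odd_rdepth_vine; last lia.
  by split=> //; lia.
rewrite (_ : k + 11 - 5 = k.+4.+2); last lia.
split=> //; first by rewrite [LHS]/= leaves_vine; lia.
exact: etrans (congr1 negb (odd_rdepth_vine k.+4.+2 (~~ rho))) (negbK rho).
Qed.

Lemma card_CAs3_large n : 10 < n -> #|CAs3 n| = n + 3.
Proof.
move=> n_gt10; pose f t := if redex t then generic_of t else t.
pose rigids := [seq rigid i (n.-2 - i) | i <- iota 0 n.-1].
pose generics := [:: generic n true true; generic n true false;
                     generic n false true; generic n false false].
have leaves_rigid i j : leaves (rigid i j) = i + j + 2.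
  by rewrite /rigid /= !leaves_zig; lia.
have genericsP t : t \in generics -> exists lam rho, t = generic n lam rho.
  by rewrite !inE => /or4P[]/eqP->; eexists; eexists.
have <- : size (rigids ++ generics) = n + 3.
  by rewrite size_cat size_map size_iota /=; lia.
apply: (card_CAs3_transversal (f := f)).
- rewrite cat_uniq; apply/and3P; split.
  + rewrite map_inj_in_uniq ?iota_uniq // => i j _ _ [] /(congr1 leaves).
    by rewrite !leaves_zig => -[].
  + apply/hasPn=> t /genericsP[lam [rho ->]]; apply/mapP=> -[i _ E].
    by have [_] := genericP lam rho n_gt10; rewrite E redex_rigid.
  + apply: (@map_uniq _ _ (fun t => (odd (ldepth t), odd (rdepth t)))).
    have parity lam rho : (odd (ldepth (generic n lam rho)),
        odd (rdepth (generic n lam rho))) = (lam, rho).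
      by have [_ _ -> ->] := genericP lam rho n_gt10.
    by rewrite !map_cons !parity.
- move=> t; rewrite mem_cat => /orP[/mapP[i i_in ->]|/genericsP[lam [rho ->]]].
    rewrite mem_iota in i_in.
    by rewrite /f redex_rigid leaves_rigid; split=> //; lia.
  have [tn red_t tl tr] := genericP lam rho n_gt10.
  by rewrite /f red_t /generic_of tn tl tr.
- move=> t tn; rewrite mem_cat /f; case: ifPn => [_|/redexPn[|i i_lt Et]];
    last 2 first.
  + by lia.
  + apply/orP; left; rewrite Et; apply/mapP.
    by exists i; rewrite -?tn // mem_iota; lia.
  apply/orP; right; rewrite /generic_of tn.
  by case: odd; case: odd; rewrite !inE eqxx ?orbT.
- move=> t tn; rewrite /f; case: ifP => // red_t.
  by apply: redex_collapses => //; rewrite tn; [lia|rewrite n_gt10 orbT].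
move=> s t _ st; rewrite /f; case: (comb_eq_redex st) => [->//|/andP[-> ->]].
exact: generic_of_eq.
Qed.

(** * The Hilbert series *)

Local Open Scope ring_scope.

Lemma coefD (f g : fps int) n :
  fps_coef (f + g) n = fps_coef f n + fps_coef g n.
Proof. by []. Qed.

Lemma coefN (f : fps int) n : fps_coef (- f) n = - fps_coef f n.
Proof. by []. Qed.

Lemma coef1 n : fps_coef (1 : fps int) n = (n == 0)%:R.
Proof. by []. Qed.

Lemma coefMn (f : fps int) k n : fps_coef (f *+ k) n = fps_coef f n *+ k.
Proof. by elim: k => // k IH; rewrite !mulrS coefD IH. Qed.

Lemma coef_var_mul (f : fps int) n :
  fps_coef ('t * f) n = if n is m.+1 then fps_coef f m else 0.
Proof.
case: n => [|n] /=; first by rewrite big_ord1 mul0r.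
rewrite !big_ord_recl /= mul0r add0r mul1r subn1 big1 ?addr0 // => i _.
by rewrite mul0r.
Qed.

Lemma coef_varX k n : fps_coef ('t ^+ k : fps int) n = (n == k)%:R.
Proof.
elim: k n => [|k IH] n; first by rewrite expr0.
by rewrite exprS coef_var_mul; case: n.
Qed.

Lemma hilbert_coef n : fps_coef hilbert_CAs3 n =
  if (10 < n)%N then (n + 3)%:R else (nth 0%N (0%N :: small_sizes) n)%:R.
Proof.
case: ltnP => [n_gt|n_le] /=.
  by rewrite (ltn_trans _ n_gt) // card_CAs3_large.
by case: n n_le => // n n_le; rewrite card_CAs3_small.
Qed.

Theorem proposition3p3 :
  hilbert_CAs3 =
    't / (1 - 't) ^+ 2 *
    (1 - 't + 't ^+ 2 + 't ^+ 3 + 2 * 't ^+ 4 + 2 * 't ^+ 5 - 7 * 't ^+ 7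
     - 2 * 't ^+ 8 + 't ^+ 9 + 2 * 't ^+ 10 + 't ^+ 11).
Proof.
have unit2 : (1 - 't : fps int) ^+ 2 \is a GRing.unit.
  exact: unitrX one_sub_var_unit.
apply: (mulIr unit2); rewrite mulrAC divrK //.
have -> : hilbert_CAs3 * (1 - 't) ^+ 2 =
          hilbert_CAs3 - ('t * hilbert_CAs3) *+ 2 + 't * ('t * hilbert_CAs3).
  ring.
(* Abstracting the powers of t keeps unification from unfolding them. *)
have [x xE x_coef] : exists2 x : nat -> fps int, (forall k, x k = 't ^+ k)
    & forall k n, fps_coef (x k) n = (n == k)%:R.
  by exists (GRing.exp 't) => // k n; apply: coef_varX.
rewrite -!xE !mulr_natl; apply: fpsP => n.
rewrite !(coefD, coefN, coefMn) !coef_var_mul.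
case: n => [|n]; first by rewrite hilbert_coef.
rewrite !(coefD, coefN, coefMn) coef1 !x_coef coef_var_mul.
do 12! [case: n => [|n]; first by rewrite !hilbert_coef].
by rewrite !hilbert_coef /= !natrD; ring.
Qed.
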